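(* Let $\alpha,\beta\in\mathbb{R}$ with $4\alpha-\beta^2>0$, and let $A_{\alpha,\beta}$ be the generalized complex algebra with structure polynomial $X^2+\beta X+\alpha$. Let $\Omega$ be a simply connected and bounded domain in the plane with sufficiently smooth boundary $\partial\Omega$, and let $\zeta\in\Omega$. Suppose $f:\overline{\Omega}\to A_{\alpha,\beta}$ is holomorphic on $\overline{\Omega}$ with respect to the structure polynomial $X^2+\beta X+\alpha$. Then $$f(\zeta)=\frac{1}{2\pi\hat{i}}\int_{\partial\Omega}\frac{f(z)}{\widetilde{z-\zeta}}\,d\tilde z .$$
   Context: $A_{\alpha,\beta}$ is the commutative $2$-dimensional real algebra of elements $x+iy$ ($x,y\in\mathbb{R}$) with product determined by $i^2=-\beta i-\alpha$, i.e. $(x_1+iy_1)(x_2+iy_2)=(x_1x_2-\alpha y_1y_2)+i(x_1y_2+y_1x_2-\beta y_1y_2)$. When $4\alpha-\beta^2>0$ (elliptic type), every nonzero element is invertible, and a quotient $a/b$ means $a\,b^{-1}$ in $A_{\alpha,\beta}$. Points $(x,y)$ of the plane are identified with $z=x+iy\in A_{\alpha,\beta}$. All products and quotients are taken in $A_{\alpha,\beta}$. Notation: for $z=x+iy$, $\tilde z=y-ix$ (so for $\zeta=\xi+i\eta$, $\widetilde{z-\zeta}=(y-\eta)-i(x-\xi)$); $d\tilde z=dy-i\,dx$, i.e. $\int_\gamma g\,d\tilde z=\int_\gamma g\,dy-i\int_\gamma g\,dx$ for $A_{\alpha,\beta}$-valued $g$; $\hat{i}=\dfrac{\beta+2i}{\sqrt{4\alpha-\beta^2}}\in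 A_{\alpha,\beta}$. The Cauchy-Riemann operator is $\partial_{\bar z}f=\frac12\left(\frac{\partial f}{\partial x}+i\,\frac{\partial f}{\partial y}\right)$. A function $f$ is holomorphic on $\overline\Omega$ with respect to $X^2+\beta X+\alpha$ if it is continuously differentiable in $x,y$ on $\overline\Omega$ and $\partial_{\bar z}f=0$. The boundary $\partial\Omega$ is positively oriented, and ''sufficiently smooth boundary'' means that the Green-Gauss formulas $\iint_\Omega\partial_x g\,dx\,dy=\int_{\partial\Omega}g\,dy$ and $\iint_\Omega\partial_y g\,dx\,dy=-\int_{\partial\Omega}g\,dx$ hold for every $g$ continuously differentiable on $\overline\Omega$. *)

(* Defs.v *)
From HB Require Import structures.
From mathcomp Require Import all_boot all_order all_algebra.
From mathcomp Require Import all_classical all_reals all_analysis.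
From mathcomp Require Import ring lra.

Set Implicit Arguments.
Unset Strict Implicit.
Unset Printing Implicit Defensive.

Import Order.TTheory GRing.Theory Num.Theory numFieldNormedType.Exports.

Local Open Scope classical_set_scope.
Local Open Scope ring_scope.

(* The algebra with structure polynomial X^2 + b X + a: [GComplex x y] is      *)
(* x + i y, with i^2 = - b i - a.  The parameters only affect the product.     *)
Record gcomplex (R : realType) (a b : R) := GComplex { gcRe : R; gcIm : R }.

Arguments GComplex {R a b} _ _.
Arguments gcRe {R a b} _.
Arguments gcIm {R a b} _.

Section GComplexRing.
Context {R : realType} {a b : R}.
Local Notation A := (gcomplex a b).

Definition pair_of_gc (u : A) : R * R := (gcRe u, gcIm u).
Definition gc_of_pair (z : R * R) : A := GComplex z.1 z.2.

Lemma pair_of_gcK : cancel pair_of_gc gc_of_pair.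
Proof. by case. Qed.

HB.instance Definition _ := Choice.copy A (can_type pair_of_gcK).

Definition gc_zero : A := GComplex 0 0.
Definition gc_one : A := GComplex 1 0.
Definition gc_opp (u : A) : A := GComplex (- gcRe u) (- gcIm u).
Definition gc_add (u v : A) : A := GComplex (gcRe u + gcRe v) (gcIm u + gcIm v).
Definition gc_mul (u v : A) : A :=
  GComplex (gcRe u * gcRe v - a * gcIm u * gcIm v)
           (gcRe u * gcIm v + gcIm u * gcRe v - b * gcIm u * gcIm v).

(* u times its conjugate (x - b y) - i y *)
Definition gc_norm (u : A) : R :=
  gcRe u ^+ 2 - b * gcRe u * gcIm u + a * gcIm u ^+ 2.
Definition gc_unit : {pred A} := fun u => gc_norm u != 0.
Definition gc_inv (u : A) : A :=
  if gc_norm u != 0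
  then GComplex ((gcRe u - b * gcIm u) / gc_norm u) (- gcIm u / gc_norm u)
  else u.

Lemma gc_addA : associative gc_add.
Proof. by move=> [? ?] [? ?] [? ?]; rewrite /gc_add /= !addrA. Qed.

Lemma gc_addC : commutative gc_add.
Proof. by move=> u v; rewrite /gc_add addrC [gcIm u + _]addrC. Qed.

Lemma gc_add0 : left_id gc_zero gc_add.
Proof. by move=> [? ?]; rewrite /gc_add /= !add0r. Qed.

Lemma gc_addN : left_inverse gc_zero gc_opp gc_add.
Proof. by move=> [? ?]; rewrite /gc_add /= !addNr. Qed.

HB.instance Definition _ :=
  GRing.isZmodule.Build A gc_addA gc_addC gc_add0 gc_addN.

Lemma gc_mulA : associative gc_mul.
Proof.
by move=> [? ?] [? ?] [? ?]; rewrite /gc_mul /=; congr GComplex; ring.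
Qed.

Lemma gc_mulC : commutative gc_mul.
Proof. by move=> [? ?] [? ?]; rewrite /gc_mul /=; congr GComplex; ring. Qed.

Lemma gc_mul1 : left_id gc_one gc_mul.
Proof. by move=> [? ?]; rewrite /gc_mul /=; congr GComplex; ring. Qed.

Lemma gc_mulDl : left_distributive gc_mul +%R.
Proof.
by move=> [? ?] [? ?] [? ?]; congr GComplex; rewrite /=; ring.
Qed.

Lemma gc_one_neq0 : gc_one != 0.
Proof. by apply/eqP => -[] /eqP; rewrite oner_eq0. Qed.

HB.instance Definition _ := GRing.Zmodule_isComNzRing.Build A
  gc_mulA gc_mulC gc_mul1 gc_mulDl gc_one_neq0.

Lemma gc_normM (u v : A) : gc_norm (u * v) = gc_norm u * gc_norm v.
Proof. by case: u v => [? ?] [? ?]; rewrite /gc_norm /=; ring. Qed.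

Lemma gc_mulV : {in gc_unit, left_inverse 1 gc_inv *%R}.
Proof.
move=> [x y] Nu; rewrite /gc_inv ifT //.
by congr GComplex; rewrite /=; move: Nu; rewrite /gc_norm /= => Nu; field.
Qed.

Lemma gc_unitPl (u v : A) : v * u = 1 -> gc_unit u.
Proof.
move=> vu1; have : gc_norm (v * u) = 1 by rewrite vu1 /gc_norm /=; ring.
rewrite gc_normM /gc_unit => N1; apply/eqP => Nu0.
by move: N1; rewrite Nu0 mulr0 => /esym/eqP; rewrite oner_eq0.
Qed.

Lemma gc_inv_out : {in [predC gc_unit], gc_inv =1 id}.
Proof. by move=> u; rewrite inE /gc_inv => /negbTE; rewrite unfold_in => ->. Qed.

HB.instance Definition _ := GRing.ComNzRing_hasMulInverse.Build A
  gc_mulV gc_unitPl gc_inv_out.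

Lemma gc_elliptic_unit (u : A) :
  0 < 4 * a - b ^+ 2 -> (u \is a GRing.unit) = (u != 0).
Proof.
move=> ab; apply/idP/idP => [uU|]; first by apply: contraTneq uU => ->; rewrite unitr0.
apply: contraR; rewrite [_ \in _]/(gc_norm u != 0) negbK => /eqP.
case: u => x y; rewrite /gc_norm /= => N0.
have e : (2 * x - b * y) ^+ 2 + (4 * a - b ^+ 2) * y ^+ 2 = 0.
  rewrite -[RHS](mulr0 4) -N0; ring.
have y0 : y = 0.
  apply/eqP; rewrite -sqrf_eq0; apply/eqP.
  have := sqr_ge0 (2 * x - b * y); have := sqr_ge0 y; nra.
move: e; rewrite y0 => e; have x0 : x = 0.
  apply/eqP; rewrite -sqrf_eq0; apply/eqP; move: e; nra.
by rewrite x0.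
Qed.

End GComplexRing.

Section Plane.
Context {R : realType}.
Implicit Types (D : set (R * R)) (g : R * R -> R) (c : R -> R * R).

Definition partial_x g (z : R * R) : R := derive1 (fun s => g (s, z.2)) z.1.
Definition partial_y g (z : R * R) : R := derive1 (fun s => g (z.1, s)) z.2.

(* g is C^1 on the closure of the open set D, in the usual sense: g is         *)
(* continuous on closure D, and its partial derivatives, which exist in D,     *)
(* extend continuously to closure D.                                           *)
Definition C1_closure D g : Prop :=
  {within closure D, continuous g} /\
  exists gx gy : R * R -> R,
    [/\ {within closure D, continuous gx},
        {within closure D, continuous gy} &
        forall z, D z ->
          [/\ derivable (fun s => g (s, z.2)) z.1 1,
              derivable (fun s => g (z.1, s)) z.2 1,
              partial_x g z = gx z & partial_y g z = gy z]].

Definition area_integral D g : R :=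
  \int[(lebesgue_measure \x lebesgue_measure)%E]_(z in D) g z.

(* Line integrals along a Lipschitz c, parametrized by [0, 1]; c is            *)
(* differentiable almost everywhere there.                                     *)
Definition line_integral_dx c g : R :=
  \int[lebesgue_measure]_(t in `[0, 1]) (g (c t) * derive1 (fun s => (c s).1) t).
Definition line_integral_dy c g : R :=
  \int[lebesgue_measure]_(t in `[0, 1]) (g (c t) * derive1 (fun s => (c s).2) t).

(* The Green-Gauss formulas for D, with c as its boundary curve. Orientation   *)
(* and multiplicity of c need not be prescribed apart from them: they hold for *)
(* a Jordan curve only if it is positively oriented (take g (x, y) = x), and   *)
(* they determine the line integrals along c of all continuous functions.      *)
Definition green_gauss D c : Prop :=
  forall g, C1_closure D g ->
    area_integral D (partial_x g) = line_integral_dy c g /\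
    area_integral D (partial_y g) = - line_integral_dx c g.

(* c is a closed rectifiable curve (any such curve has a Lipschitz             *)
(* parametrization) that runs over the boundary of the open set D, for which   *)
(* the Green-Gauss formulas hold.                                              *)
Definition smooth_boundary D c : Prop :=
  [/\ [lipschitz c t | t in `[0, 1]], c 0 = c 1,
      c @` `[0, 1] = closure D `\` D & green_gauss D c].

Definition path_in D c : Prop :=
  {within `[0, 1], continuous c} /\ (forall t, 0 <= t <= 1 -> D (c t)).

Definition simply_connected D : Prop :=
  (forall p q, D p -> D q -> exists c, [/\ path_in D c, c 0 = p & c 1 = q]) /\
  (forall c, path_in D c -> c 0 = c 1 ->
    exists H : R * R -> R * R,
      [/\ {within `[0, 1] `*` `[0, 1], continuous H},
          forall s t, 0 <= s <= 1 -> 0 <= t <= 1 -> D (H (s, t)),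
          forall t, 0 <= t <= 1 -> H (0, t) = c t /\ H (1, t) = c 0 &
          forall s, 0 <= s <= 1 -> H (s, 0) = c 0 /\ H (s, 1) = c 0]).

End Plane.

Section GComplexAnalysis.
Context {R : realType} {a b : R}.
Local Notation A := (gcomplex a b).
Implicit Types (f g : R * R -> A) (D : set (R * R)) (c : R -> R * R).

Definition gc_real (x : R) : A := GComplex x 0.
Definition gc_i : A := GComplex 0 1.

Definition gc_ihat : A :=
  (gc_real b + 2 * gc_i) / gc_real (Num.sqrt (4 * a - b ^+ 2)).

Definition gc_tilde (z : R * R) : A := gc_real z.2 - gc_i * gc_real z.1.

Definition gc_partial_x f (z : R * R) : A :=
  GComplex (partial_x (gcRe \o f) z) (partial_x (gcIm \o f) z).
Definition gc_partial_y f (z : R * R) : A :=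
  GComplex (partial_y (gcRe \o f) z) (partial_y (gcIm \o f) z).

Definition dbar f (z : R * R) : A :=
  gc_real 2^-1 * (gc_partial_x f z + gc_i * gc_partial_y f z).

(* By continuity, it amounts to the same to have dbar f = 0 on D or, for the   *)
(* extended partial derivatives, on closure D.                                 *)
Definition holomorphic_closure D f : Prop :=
  [/\ C1_closure D (gcRe \o f), C1_closure D (gcIm \o f) &
      forall z, D z -> dbar f z = 0].

Definition gc_line_integral_dx c g : A :=
  GComplex (line_integral_dx c (gcRe \o g)) (line_integral_dx c (gcIm \o g)).
Definition gc_line_integral_dy c g : A :=
  GComplex (line_integral_dy c (gcRe \o g)) (line_integral_dy c (gcIm \o g)).
Definition line_integral_dtilde c g : A :=
  gc_line_integral_dy c g - gc_i * gc_line_integral_dx c g.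

End GComplexAnalysis.

Arguments gc_real {R a b}.
Arguments gc_i {R a b}.
Arguments gc_ihat {R} a b.
Arguments gc_tilde {R} a b.

(* Main.v *)
Require Import Defs.
From mathcomp Require Import all_boot all_order all_algebra.
From mathcomp Require Import all_classical all_reals all_analysis.
From mathcomp Require Import measurable_realfun.
From mathcomp Require Import ring lra.
Import Order.TTheory GRing.Theory Num.Theory numFieldNormedType.Exports.
Local Open Scope classical_set_scope.
Local Open Scope ring_scope.
Set Implicit Arguments.
Unset Strict Implicit.

(** Write w for the tilde of z - zeta, w* for its conjugate and N = w w* for its
norm, a positive definite quadratic form in z - zeta. Both f and w are holomorphic,
hence f / w is too, but it has a pole at zeta. Since 1 / w = w* / N, replacing 1 / N
by a C1 function [cutoff] of N that agrees with it for N >= r gives a function g that is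
C1 on the whole closure and equals f / w outside the ellipse N < r. No disc has to
be removed from the domain: the formulas of Green and Gauss are applied to g on
Omega itself, and they turn the line integral of f / w into the area integral of
(d/dx + i d/dy) g.

This is computed in closed form. As (d/dx + i d/dy) w* = b + 2 i, one finds
(d/dx + i d/dy) g = (b + 2 i) hat(N) f, where [hat] is the derivative of
s |-> s cutoff(s), a nonnegative real function that vanishes for s >= r
([green_smoothed]). Its integral over the plane is 2 pi / sqrt (4 a - b ^ 2), whatever
r is ([integral_hat]; iterated integration over the slices of the ellipse). So,
up to this factor, the area integral is an average of f over the
ellipse N < r ([area_hat_near]), while the line integral does not depend on r.
Letting the ellipse shrink to zeta, by continuity of f the line integral is
(b + 2 i) 2 pi / sqrt (4 a - b ^ 2) f(zeta), which is 2 pi ihat f(zeta). *)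

(** * Measurability and integrability in the plane *)

Section PlaneMeasure.
Context {R : realType}.

(** The Borel sets of the plane must be compared with the product sigma-algebra:
an open set is the union of the countably many boxes with rational centre and
radii that it contains. *)
Lemma open_plane_measurable (S : set (R * R)) : open S -> measurable S.
Proof.
move=> oS.
pose box (q : rat * rat * (rat * rat)) : set (R * R) :=
  ball (ratr q.1.1 : R) (ratr q.1.2) `*` ball (ratr q.2.1 : R) (ratr q.2.2).
have -> : S = \bigcup_q (if `[< box q `<=` S >] then box q else set0).
  apply/seteqP; split=> [p Sp|p [q _]]; last by case: asboolP => [qS /qS|].
  have [[U1 U2] /= [U1p U2p] US] := open_nbhs_nbhs (conj oS Sp).
  have [c1 [r1 [p1 B1]]] := open_subball_rat (open_interior U1) (mem_set U1p).
  have [c2 [r2 [p2 B2]]] := open_subball_rat (open_interior U2) (mem_set U2p).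
  exists ((c1, r1), (c2, r2)) => //=; rewrite ifT; first by split; apply/set_mem.
  by apply/asboolP => z [/= /B1/interior_subset z1 /B2/interior_subset z2]; apply: US.
apply: countable_bigcupT_measurable => // q; case: asboolP => // _.
by apply: measurableX; apply: open_measurable; exact: ball_open.
Qed.

Lemma open_plane_measurable_subspace (D : set (R * R)) (U : set (subspace D)) :
  open D -> open U -> measurable (D `&` U).
Proof.
move=> oD /open_subspaceP [V oV VD]; rewrite setIC -VD.
by apply: open_plane_measurable; apply: openI.
Qed.

Lemma continuous_plane_measurable_fun (D : set (R * R)) (g : subspace D -> R) :
  open D -> continuous g -> measurable_fun D g.
Proof.
move=> oD /continuousP cg.
apply: (measurability _ (RGenOpens.measurableE R)).
move=> _ [_ [u [v ->] <-]]; apply: open_plane_measurable_subspace => //.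
by apply: cg; exact: interval_open.
Qed.

Definition square (M : R) : set (R * R) := `[- M, M]%classic `*` `[- M, M]%classic.

Lemma bounded_sub_square (D : set (R * R)) : bounded_set D -> exists M, D `<=` square M.
Proof.
move=> [M [Mr MD]]; exists (M + 1) => z Dz.
have := MD (M + 1) (ltr_pwDr ltr01 (lexx M)) z Dz.
rewrite /= [`|_|]prod_normE ge_max => /andP[z1 z2].
by split; rewrite /= in_itv /= -ler_norml.
Qed.

Lemma bounded_closure_compact (D : set (R * R)) : bounded_set D -> compact (closure D).
Proof.
move=> /bounded_sub_square[M DM].
have cM : compact (square M) by apply: compact_setX; exact: segment_compact.
have clM : closed (square M) by apply: compact_closed => //; exact: norm_hausdorff.
apply: (subclosed_compact (@closed_closure _ D) cM).
by move=> z /(closure_subset DM); rewrite -(proj1 (closure_id _) clM).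
Qed.

Lemma bounded_plane_measure_lty (D : set (R * R)) : measurable D -> bounded_set D ->
  ((lebesgue_measure \x lebesgue_measure)%E D < +oo)%E.
Proof.
move=> mD /bounded_sub_square[M DM].
apply: (@le_lt_trans _ _ ((lebesgue_measure \x lebesgue_measure)%E (square M))).
  by apply: le_measure => //; rewrite ?inE //; apply: measurableX.
have MM : (lebesgue_measure (`[(- M)%R, M]%classic : set R) < +oo)%E.
  by rewrite lebesgue_measure_itv /=; case: ifP; rewrite // -EFinD ltry.
rewrite /square product_measure1E //; apply: lte_mul_pinfty => //.
by rewrite ge0_fin_numE.
Qed.

(** Continuity up to the boundary makes the function bounded, since the closure
is compact; this is what makes every area integral below additive. *)
Lemma continuous_closure_integrable (D : set (R * R)) (g : R * R -> R) :
  open D -> bounded_set D -> {within closure D, continuous g} ->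
  (lebesgue_measure \x lebesgue_measure)%E.-integrable D (EFin \o g).
Proof.
move=> oD bD cg.
have mD := open_plane_measurable oD.
apply: measurable_bounded_integrable => //.
- exact: bounded_plane_measure_lty.
- apply: continuous_plane_measurable_fun => //.
  exact: continuous_subspaceW (@subset_closure _ D) cg.
- have /compact_bounded [M [Mr Mg]] := continuous_compact cg (bounded_closure_compact bD).
  exists M; split=> // x Mx z Dz; apply: Mg Mx _ _.
  by exists z => //; exact: subset_closure.
Qed.

Lemma area_linear (D : set (R * R)) (u v : R * R -> R) (s t : R) :
  open D -> bounded_set D ->
  {within closure D, continuous u} -> {within closure D, continuous v} ->
  area_integral D (fun z => s * u z + t * v z) =
  s * area_integral D u + t * area_integral D v.
Proof.
move=> oD bD cu cv; have mD := open_plane_measurable oD.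
have scaled k (w : R * R -> R) : {within closure D, continuous w} ->
    {within closure D, continuous (fun z => k * w z)}.
  by move=> cw z; apply: cvgM; [exact: cvg_cst|exact: cw].
rewrite /area_integral RintegralD ?RintegralZl //;
  by apply: continuous_closure_integrable => //; apply: scaled.
Qed.

Lemma eq_area (D : set (R * R)) (u v : R * R -> R) : (forall z, D z -> u z = v z) ->
  area_integral D u = area_integral D v.
Proof. by move=> uv; apply: eq_Rintegral => z; rewrite inE => /uv. Qed.

End PlaneMeasure.

(** * Three integrals on the line *)

Section LineIntegrals.
Context {R : realType}.
Implicit Types (a b r m k A : R).

Lemma derivable_continuous (F : R -> R) : (forall x : R, derivable F x 1) -> continuous F.
Proof.
by move=> dF x; apply: differentiable_continuous; apply/derivable1_diffP; apply: dF.
Qed.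

Lemma derivable_LRcontinuous (F : R -> R) a b : (forall x : R, derivable F x 1) ->
  derivable_oo_LRcontinuous F a b.
Proof.
move=> dF; have cF := derivable_continuous dF.
by split=> [x _ //| |]; [apply: cvg_at_right_filter | apply: cvg_at_left_filter]; apply: cF.
Qed.

Lemma integral_is_derive (F f : R -> R) a b : a <= b ->
  (forall x : R, is_derive x 1 F (f x)) -> continuous f ->
  (\int[lebesgue_measure]_(x in `[a, b]) (f x)%:E = (F b - F a)%:E)%E.
Proof.
rewrite le_eqVlt => /orP[/eqP <- _ _|ab dF cf].
  by rewrite subrr set_itv1 integral_set1.
rewrite (continuous_FTC2 (F := F) ab) //.
- by move=> x; apply: continuous_subspaceT.
- by apply: derivable_LRcontinuous => x; case: (dF x).
- by move=> x _; rewrite derive1E; apply: derive_val.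
Qed.

Lemma integralT_supp (f : R -> R) a b : (forall x, x \notin `[a, b] -> f x = 0) ->
  (\int[lebesgue_measure]_x (f x)%:E = \int[lebesgue_measure]_(x in `[a, b]) (f x)%:E)%E.
Proof.
move=> f0; rewrite [RHS]integral_mkcond; apply: eq_integral => x _.
rewrite patchE; case: ifPn => // xab; rewrite f0 //.
by apply: contra xab; rewrite inE.
Qed.

(** The root of a negative number is 0, so the formula also covers the case where
the integrand vanishes identically. *)
Lemma integral_parabola k A :
  (\int[lebesgue_measure]_y (Num.max 0 (A - (y + k) ^+ 2))%:E =
   (4 / 3 * (A * Num.sqrt A))%:E)%E.
Proof.
set s := Num.sqrt A; have s0 : 0 <= s := sqrtr_ge0 _.
have sA y : - k - s <= y <= - k + s -> 0 <= s ^+ 2 - (y + k) ^+ 2.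
  by move=> /andP[y1 y2]; nra.
rewrite (@integralT_supp _ (- k - s) (- k + s)); last first.
  move=> y yN; apply/max_idPl; rewrite subr_le0 leNgt; apply: contra yN => yA.
  have A0 : 0 <= A := le_trans (sqr_ge0 _) (ltW yA).
  move: yA; rewrite -(sqr_sqrtr A0) -/s => yA; rewrite in_itv /=; apply/andP; split; nra.
have [A0|A0] := lerP A 0.
  have s00 : s = 0 by apply/eqP; rewrite sqrtr_eq0.
  by rewrite s00 subr0 addr0 set_itv1 integral_set1 !mulr0.
have As : A = s ^+ 2 by rewrite sqr_sqrtr // ltW.
rewrite As; transitivity (\int[lebesgue_measure]_(y in `[(- k - s)%R, (- k + s)%R])
   (s ^+ 2 - (y + k) ^+ 2)%:E)%E.
  apply: eq_integral => y; rewrite inE /= in_itv /= => /sA sy.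
  by congr EFin; apply/max_idPr.
pose F (y : R) : R := s ^+ 2 * y + - ((y + k) * ((y + k) * (y + k)) * 3^-1).
have dF (y : R) : is_derive y 1 F (s ^+ 2 - (y + k) ^+ 2).
  by apply: is_derive_eq; rewrite /GRing.scale /=; field.
rewrite (integral_is_derive _ dF); first by congr EFin; rewrite /F; field.
- lra.
- by apply: derivable_continuous => y; apply: ex_derive.
Qed.

Lemma integral_cos4 :
  (\int[lebesgue_measure]_(t in `[(- (pi / 2))%R, (pi / 2)%R]) (cos t ^+ 4 : R)%:E =
   (3 / 8 * pi)%:E)%E.
Proof.
have pi0 : 0 < pi / 2 :> R by rewrite divr_gt0 ?pi_gt0.
pose F (t : R) : R := 3 / 8 * t + (3 / 8 * (sin t * cos t)
  + 4^-1 * (sin t * (cos t * (cos t * cos t)))).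
have dF (t : R) : is_derive t 1 F (cos t ^+ 4).
  apply: is_derive_eq; rewrite /GRing.scale /=.
  have s2 : sin t ^+ 2 = 1 - cos t ^+ 2 by rewrite sin2cos2.
  transitivity (3 / 8 + 3 / 8 * (cos t ^+ 2 - sin t ^+ 2)
    + 4^-1 * (cos t ^+ 4 - 3 * sin t ^+ 2 * cos t ^+ 2)); first by field.
  by rewrite s2; field.
rewrite (integral_is_derive _ dF).
- by congr EFin; rewrite /F sinN cosN cos_pihalf; field.
- lra.
- by apply: derivable_continuous => y; apply: ex_derive.
Qed.

(** The integrand is supported on an interval, which is parametrized by
x = x0 + (sqrt r / m) sin t: this turns it into a multiple of the fourth power
of the cosine. *)
Lemma integral_ellipse_slices r m x0 : 0 < r -> 0 < m ->
  (\int[lebesgue_measure]_x ((r - m ^+ 2 * (x - x0) ^+ 2) *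
     Num.sqrt (r - m ^+ 2 * (x - x0) ^+ 2))%:E = (3 / 8 * pi * (r ^+ 2 / m))%:E)%E.
Proof.
move=> r0 m0; set q := Num.sqrt r / m.
have q0 : 0 < q by rewrite divr_gt0 // sqrtr_gt0.
have qm : m * q = Num.sqrt r by rewrite mulrC divfK // gt_eqF.
have rq : r = (m * q) ^+ 2 by rewrite qm sqr_sqrtr // ltW.
pose F t : R := x0 + q * sin t.
have pi0 : 0 < pi / 2 :> R by rewrite divr_gt0 ?pi_gt0.
have dF (t : R) : is_derive t 1 F (q * cos t).
  by apply: is_derive_eq; rewrite /GRing.scale /=; ring.
have dFE : derive1 F = fun t => q * cos t.
  by apply/funext => t; rewrite derive1E derive_val.
have cdF : continuous (fun t => q * cos t : R).
  by apply: derivable_continuous => t; apply: ex_derive.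
have Fr : F (pi / 2) = x0 + q by rewrite /F sin_pihalf mulr1.
have Fl : F (- (pi / 2)) = x0 - q by rewrite /F sinN sin_pihalf mulrN1.
rewrite (@integralT_supp _ (F (- (pi / 2))) (F (pi / 2))); last first.
  move=> x; rewrite Fl Fr => xN; rewrite (_ : Num.sqrt _ = 0) ?mulr0 //.
  apply/eqP; rewrite sqrtr_eq0 leNgt; apply: contra xN => xr.
  have {}xr : (x - x0) ^+ 2 < q ^+ 2.
    by rewrite -(ltr_pM2l (exprn_gt0 2 m0)) -subr_gt0 -exprMn -rq.
  by rewrite in_itv /=; apply/andP; split; nra.
rewrite integration_by_substitution_increasing.
- transitivity (\int[lebesgue_measure]_(t in `[(- (pi / 2))%R, (pi / 2)%R])
    ((r ^+ 2 / m)%:E * (cos t ^+ 4)%:E))%E.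
    apply: eq_integral => t; rewrite inE /= in_itv /= => tpi.
    rewrite -EFinM; congr EFin; rewrite fctE /= dFE.
    have ct : 0 <= cos t by apply: cos_ge0_pihalf.
    have -> : r - m ^+ 2 * (F t - x0) ^+ 2 = (m * q * cos t) ^+ 2.
      by rewrite rq /F [in RHS]exprMn cos2sin2; ring.
    rewrite sqrtr_sqr ger0_norm; last by rewrite mulr_ge0 // qm sqrtr_ge0.
    by rewrite rq; field; rewrite gt_eqF.
  rewrite integralZl //; last first.
    apply: continuous_compact_integrable; first exact: segment_compact.
    apply: continuous_subspaceT.
    by apply: derivable_continuous => x; apply: ex_derive.
  by rewrite integral_cos4 -EFinM mulrC.
- by lra.
- by move=> x y xpi ypi xy; rewrite ltrD2l ltr_pM2l // ltr_sin.
- by rewrite dFE => x _; exact: cdF.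
- rewrite dFE; apply/cvg_ex; exists (q * cos (- (pi / 2))).
  by apply: cvg_at_right_filter; exact: cdF.
- rewrite dFE; apply/cvg_ex; exists (q * cos (pi / 2)).
  by apply: cvg_at_left_filter; exact: cdF.
- by apply: derivable_LRcontinuous => x; case: (dF x).
- apply: continuous_subspaceT.
  have cA : continuous (fun x : R => r - m ^+ 2 * (x - x0) ^+ 2).
    by apply: derivable_continuous => x; apply: ex_derive.
  move=> x; apply: cvgM; first exact: cA.
  by apply: continuous_comp; [exact: cA|exact: sqrt_continuous].
Qed.

End LineIntegrals.

(** * Calculus of C1 functions up to the boundary *)

Section C1.
Context {R : realType}.
Implicit Types (D : set (R * R)) (g u v : R * R -> R).

(** A quadratic error bound gives differentiability at points where a function is
glued from two formulas, without any case distinction on the side. *)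
Lemma is_derive_quadratic (g : R -> R) (x d C : R) :
  (forall s, `|g s - g x - d * (s - x)| <= C * (s - x) ^+ 2) -> is_derive x 1 g d.
Proof.
move=> gC; have H : (fun h : R => h^-1 *: (g (h *: (1 : R) + x) - g x) : R) @ 0^' --> d.
  have C0 : (fun h : R => C * `|h|) @ 0^' --> C * `|0 : R|.
    apply: cvg_within_filter.
    by apply: cvgM; [exact: cvg_cst|apply: cvg_norm; exact: cvg_id].
  rewrite normr0 mulr0 in C0.
  apply/cvgrPdist_le => e e0; near=> h.
  have h0 : h != 0 by near: h; exact: nbhs_dnbhs_neq.
  have := gC (h + x); rewrite addrK => gh.
  rewrite distrC; apply: (@le_trans _ _ (C * `|h|)).
    have e2 : `|h| * (C * `|h|) = C * h ^+ 2 by rewrite mulrCA -expr2 real_normK ?num_real.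
    rewrite -(ler_pM2l (_ : 0 < `|h|)) ?normr_gt0 // -normrM mulrBr /= /GRing.scale /=.
    by rewrite mulVKf // mulr1 [h * d]mulrC e2.
  apply: le_trans (ler_norm _) _; rewrite -[_ * _]subr0 distrC.
  near: h; move/cvgrPdist_le : C0; exact.
by apply: DeriveDef; [exact: cvgP H|exact: cvg_lim H].
Unshelve. all: by end_near. Qed.

(** [C1_closure] with its partial derivatives named: the sum, product and chain
rules then compute these explicitly, which the use of Green's formulas requires. *)
Definition C1_with D g gx gy : Prop :=
  [/\ {within closure D, continuous g}, {within closure D, continuous gx},
      {within closure D, continuous gy} &
      forall z, D z -> is_derive (z.1 : R) 1 (fun s => g (s, z.2)) (gx z) /\
                       is_derive (z.2 : R) 1 (fun s => g (z.1, s)) (gy z)].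

Lemma C1_with_closure D g gx gy : C1_with D g gx gy -> C1_closure D g.
Proof.
move=> [cg cgx cgy dg]; split=> //; exists gx, gy; split=> // z Dz.
by have [[? ?] [? ?]] := dg _ Dz; rewrite /partial_x /partial_y !derive1E.
Qed.

Lemma C1_closure_with D g : C1_closure D g -> exists gx gy, C1_with D g gx gy.
Proof.
move=> [cg [gx [gy [cgx cgy dg]]]]; exists gx, gy; split=> // z /dg[dx dy <- <-].
by rewrite /partial_x /partial_y !derive1E; split; apply: derivableP.
Qed.

Lemma C1_withE D g gx gy z : C1_with D g gx gy -> D z ->
  partial_x g z = gx z /\ partial_y g z = gy z.
Proof.
by move=> [_ _ _ dg] /dg[[_ <-] [_ <-]]; rewrite /partial_x /partial_y !derive1E.
Qed.

Lemma C1_with_eq D g gx gy g' gx' gy' : C1_with D g gx gy ->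
  g =1 g' -> gx =1 gx' -> gy =1 gy' -> C1_with D g' gx' gy'.
Proof. by move=> H /funext <- /funext <- /funext <-. Qed.

Lemma C1_with_cst D (k : R) : C1_with D (fun=> k) (fun=> 0) (fun=> 0).
Proof.
split; try by apply: continuous_subspaceT => z; exact: cvg_cst.
by move=> z _; split; exact: is_derive_cst.
Qed.

Lemma C1_with_fst D (k : R) : C1_with D (fun z => z.1 - k) (fun=> 1) (fun=> 0).
Proof.
split; try by apply: continuous_subspaceT => z; exact: cvg_cst.
  apply: continuous_subspaceT => z; apply: cvgB; [exact: cvg_fst|exact: cvg_cst].
move=> z _; split=> /=; last exact: is_derive_cst.
by apply: is_derive_eq; rewrite subr0.
Qed.

Lemma C1_with_snd D (k : R) : C1_with D (fun z => z.2 - k) (fun=> 0) (fun=> 1).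
Proof.
split; try by apply: continuous_subspaceT => z; exact: cvg_cst.
  apply: continuous_subspaceT => z; apply: cvgB; [exact: cvg_snd|exact: cvg_cst].
move=> z _; split=> /=; first exact: is_derive_cst.
by apply: is_derive_eq; rewrite subr0.
Qed.

Lemma C1_withD D u ux uy v vx vy : C1_with D u ux uy -> C1_with D v vx vy ->
  C1_with D (fun z => u z + v z) (fun z => ux z + vx z) (fun z => uy z + vy z).
Proof.
move=> [cu cux cuy du] [cv cvx cvy dv]; split.
- by move=> z; apply: cvgD; [exact: cu|exact: cv].
- by move=> z; apply: cvgD; [exact: cux|exact: cvx].
- by move=> z; apply: cvgD; [exact: cuy|exact: cvy].
- by move=> z Dz; have [? ?] := du _ Dz; have [? ?] := dv _ Dz; split; exact: is_deriveD.
Qed.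

Lemma C1_withM D u ux uy v vx vy : C1_with D u ux uy -> C1_with D v vx vy ->
  C1_with D (fun z => u z * v z) (fun z => ux z * v z + u z * vx z)
    (fun z => uy z * v z + u z * vy z).
Proof.
move=> [cu cux cuy du] [cv cvx cvy dv]; split.
- by move=> z; apply: cvgM; [exact: cu|exact: cv].
- by move=> z; apply: cvgD; apply: cvgM; [exact: cux|exact: cv|exact: cu|exact: cvx].
- by move=> z; apply: cvgD; apply: cvgM; [exact: cuy|exact: cv|exact: cu|exact: cvy].
- move=> z Dz; have [? ?] := du _ Dz; have [? ?] := dv _ Dz.
  by split; apply: is_derive_eq; rewrite /GRing.scale /= -surjective_pairing addrC [v z * _]mulrC.
Qed.

Lemma C1_with_comp D u ux uy (c c' : R -> R) :
  (forall s : R, is_derive s 1 c (c' s)) -> continuous c' ->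
  C1_with D u ux uy ->
  C1_with D (fun z => c (u z)) (fun z => c' (u z) * ux z) (fun z => c' (u z) * uy z).
Proof.
move=> dc cc' [cu cux cuy du].
have cc : continuous c.
  move=> s; apply: differentiable_continuous; apply/derivable1_diffP.
  by case: (dc s).
have comp (h : R -> R) : continuous h -> {within closure D, continuous (fun z => h (u z))}.
  by move=> ch z; apply: continuous_comp; [exact: cu|exact: ch].
split; first exact: comp.
- by move=> z; apply: cvgM; [exact: comp|exact: cux].
- by move=> z; apply: cvgM; [exact: comp|exact: cuy].
- move=> [x y] Dxy; have [dux duy] := du _ Dxy.
  split; [exact: (is_derive1_comp (dc _) dux)|exact: (is_derive1_comp (dc _) duy)].
Qed.

End C1.

(** * A C1 substitute for the inverse near 0 *)

Section Cutoff.
Context {R : realType} (r : R).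
Hypothesis r0 : 0 < r.
Implicit Types (s x : R).

(** The C1 continuation of 1 / s from [r, +oo[ by its tangent at r. *)
Definition cutoff s : R := 2 / Num.max r s - s / Num.max r s ^+ 2.
Definition dcutoff s : R := - (Num.max r s ^+ 2)^-1.
(** The derivative of s * cutoff s, see [hatE]. *)
Definition hat s : R := 2 / r ^+ 2 * Num.max 0 (r - s).

Let max0 s : 0 < Num.max r s.
Proof. by rewrite lt_max r0. Qed.

Lemma cutoff_inv s : r <= s -> cutoff s = s^-1.
Proof.
move=> rs; have s0 : s != 0 by rewrite gt_eqF // (lt_le_trans r0).
by rewrite /cutoff (max_idPr rs); field.
Qed.

Lemma hatE s : hat s = cutoff s + s * dcutoff s.
Proof.
have r1 : r != 0 by rewrite gt_eqF.
rewrite /hat /cutoff /dcutoff; have [rs|sr] := leP r s.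
  have s0 : s != 0 by rewrite gt_eqF // (lt_le_trans r0).
  have -> : Num.max 0 (r - s) = 0 by apply/max_idPl; rewrite subr_le0.
  by field; rewrite ?s0 ?r1.
have -> : Num.max 0 (r - s) = r - s by apply/max_idPr; rewrite subr_ge0 ltW.
by field; rewrite ?s0 ?r1.
Qed.

Lemma hat_ge0 s : 0 <= hat s.
Proof. by rewrite /hat mulr_ge0 ?divr_ge0 ?sqr_ge0 // le_max lexx. Qed.

Lemma hat_eq0 s : r <= s -> hat s = 0.
Proof.
by move=> rs; rewrite /hat (_ : Num.max _ _ = 0) ?mulr0 //; apply/max_idPl; rewrite subr_le0.
Qed.

(** With p0 = 1 / max (r, s), cutoff s is 2 p0 - s p0 ^ 2: the value at s of the
upper envelope of the affine functions s |-> 2 p - s p ^ 2 for 0 < p <= 1 / r.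
Being an upper envelope, cutoff lies above its tangent at every point. *)
Lemma cutoff_max s p : 0 < p <= r^-1 -> 2 * p - s * p ^+ 2 <= cutoff s.
Proof.
move=> /andP[p0 pr]; have i0 : 0 < r^-1 by rewrite invr_gt0.
have ri : r * r^-1 = 1 by rewrite mulfV // gt_eqF.
rewrite -subr_ge0; have [rs|sr] := leP r s.
  have s0 : 0 < s := lt_le_trans r0 rs.
  rewrite cutoff_inv // (_ : _ - _ = (1 - s * p) ^+ 2 / s); last by field; rewrite gt_eqF.
  by rewrite divr_ge0 ?sqr_ge0 // ltW.
rewrite /cutoff (max_idPl (ltW sr)) -exprVn.
rewrite (_ : _ - _ = (r^-1 - p) * (2 - s * (r^-1 + p))); last by ring.
apply: mulr_ge0; first by rewrite subr_ge0.
have [s0|s0] := lerP 0 s.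
  have si : s * r^-1 <= 1 by rewrite -ri ler_pM2r // ltW.
  have sp : s * p <= s * r^-1 by rewrite ler_wpM2l.
  by rewrite mulrDr; lra.
have := mulr_gt0 (ltr_pwDr p0 (ltW i0)) (_ : 0 < - s); rewrite oppr_gt0 => /(_ s0); lra.
Qed.

Lemma lipschitz_inv_max s x :
  `|(Num.max r s)^-1 - (Num.max r x)^-1| <= (r^-1) ^+ 2 * `|s - x|.
Proof.
set M := Num.max r s; set L := Num.max r x.
have M0 : 0 < M by exact: max0.
have L0 : 0 < L by exact: max0.
have -> : M^-1 - L^-1 = M^-1 * L^-1 * (L - M) by field; rewrite !gt_eqF.
rewrite normrM gtr0_norm ?mulr_gt0 ?invr_gt0 //.
apply: ler_pM => //; first by rewrite mulr_ge0 // invr_ge0 ltW.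
  rewrite expr2; apply: ler_pM; rewrite ?invr_ge0 ?(ltW M0) ?(ltW L0) //;
  by rewrite lef_pV2 // le_max lexx.
have := ler_norm (s - x); have := ler_norm (x - s); rewrite distrC ler_norml.
by rewrite /L /M; have [] := leP r x; have [] := leP r s => *; apply/andP; split; lra.
Qed.

(** Convexity, applied at s and at x, encloses the error of the tangent between 0
and the product of x - s with the increment of the slope, which is Lipschitz. *)
Lemma is_derive_cutoff s : is_derive s 1 cutoff (dcutoff s).
Proof.
apply: (@is_derive_quadratic _ _ _ _ (2 * (r^-1) ^+ 3)) => x.
have inv_max y : 0 < (Num.max r y)^-1 <= r^-1.
  by rewrite invr_gt0 max0 lef_pV2 ?posrE ?max0 // le_max lexx.
have := cutoff_max s (inv_max x); have := cutoff_max x (inv_max s).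
have := lipschitz_inv_max s x; move: (inv_max x) (inv_max s).
rewrite /cutoff /dcutoff -!exprVn.
set p := (Num.max r s)^-1; set q := (Num.max r x)^-1; set i := r^-1.
move=> /andP[q0 qi] /andP[p0 pi] pq e1 e2.
rewrite ger0_norm; last by lra.
apply: (@le_trans _ _ ((p ^+ 2 - q ^+ 2) * (x - s))); first by lra.
rewrite subr_sqr; apply: le_trans (ler_norm _) _.
rewrite !normrM [`|p + q|]gtr0_norm ?addr_gt0 //.
rewrite -(real_normK (num_real (x - s))) [`|x - s|]distrC.
have i0 : 0 <= i by rewrite ltW // (lt_le_trans p0).
have pqi : (p + q) * `|p - q| <= (2 * i) * (i ^+ 2 * `|s - x|).
  by apply: ler_pM => //; lra.
have -> : 2 * i ^+ 3 * `|s - x| ^+ 2 = 2 * i * (i ^+ 2 * `|s - x|) * `|s - x| by ring.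
by rewrite ler_wpM2r // mulrC.
Qed.

Lemma continuous_dcutoff : continuous dcutoff.
Proof.
move=> s; apply: cvgN; apply: cvgV; first by rewrite expf_neq0 // gt_eqF.
rewrite expr2; apply: cvgM;
  (apply: (@continuous_max _ _ (cst r) id); [exact: cvg_cst|exact: cvg_id]).
Qed.

End Cutoff.

(** * The norm form and the mass of the hat *)

Section Form.
Context {R : realType} (a b : R).
Hypothesis hab : 0 < 4 * a - b ^+ 2.
Variable zeta : R * R.
Implicit Types (r : R) (z : R * R).

(** The norm form of the algebra at the tilde of z - zeta; as the algebra is
elliptic, its sublevel sets are ellipses centred at zeta. *)
Definition tilde_norm z : R :=
  (z.2 - zeta.2) ^+ 2 + b * (z.1 - zeta.1) * (z.2 - zeta.2) + a * (z.1 - zeta.1) ^+ 2.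

Lemma gc_tildeE z : gc_tilde a b z = GComplex z.2 (- z.1).
Proof. by rewrite /gc_tilde; congr GComplex; rewrite /=; ring. Qed.

Lemma gc_norm_tilde z : gc_norm (gc_tilde a b (z - zeta)) = tilde_norm z.
Proof. by rewrite gc_tildeE /gc_norm /tilde_norm /=; ring. Qed.

Lemma a_gt0 : 0 < a.
Proof. by move: hab (sqr_ge0 b) => ab b0; lra. Qed.

(** Multiplied by 4 and by 4 a, the form dominates (4 a - b ^ 2) times the square of
each coordinate: complete the square. *)
Lemma tilde_norm_small (d : R) : 0 < d -> exists2 r, 0 < r &
  forall z, tilde_norm z < r -> `|z.1 - zeta.1| < d /\ `|z.2 - zeta.2| < d.
Proof.
move=> d0; set D := 4 * a - b ^+ 2; have a0 := a_gt0.
have Dd : 0 < D * d ^+ 2 by rewrite mulr_gt0 // exprn_gt0.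
exists (D * d ^+ 2 / (4 * (1 + a))).
  by rewrite divr_gt0 // mulr_gt0 // addr_gt0.
move=> z; rewrite ltr_pdivlMr ?mulr_gt0 ?addr_gt0 // /tilde_norm.
set x := z.1 - zeta.1; set y := z.2 - zeta.2 => H.
have hx : D * x ^+ 2 <= 4 * (y ^+ 2 + b * x * y + a * x ^+ 2).
  by rewrite -subr_ge0 (_ : _ - _ = (2 * y + b * x) ^+ 2) ?sqr_ge0 // /D; ring.
have hy : D * y ^+ 2 <= 4 * a * (y ^+ 2 + b * x * y + a * x ^+ 2).
  by rewrite -subr_ge0 (_ : _ - _ = (2 * a * x + b * y) ^+ 2) ?sqr_ge0 // /D; ring.
have q0 : 0 <= y ^+ 2 + b * x * y + a * x ^+ 2.
  by rewrite -(pmulr_rge0 _ (ltr0n R 4)) (le_trans _ hx) // mulr_ge0 ?sqr_ge0 // ltW.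
have lt_sq (t : R) : D * t ^+ 2 < D * d ^+ 2 -> `|t| < d.
  by rewrite ltr_pM2l // -[t ^+ 2]real_normK ?num_real // ltr_pXn2r // nnegrE ltW.
have aq0 := mulr_ge0 (ltW a0) q0; move: H hx hy q0 aq0.
set q := y ^+ 2 + _ + _ => H hx hy q0 aq0.
by split; apply: lt_sq; lra.
Qed.

Lemma continuous_tilde_norm : continuous tilde_norm.
Proof.
have cx : continuous (fun z : R * R => z.1 - zeta.1).
  by move=> z; apply: cvgB; [exact: cvg_fst|exact: cvg_cst].
have cy : continuous (fun z : R * R => z.2 - zeta.2).
  by move=> z; apply: cvgB; [exact: cvg_snd|exact: cvg_cst].
move=> z; rewrite /tilde_norm; under eq_fun do rewrite !expr2.
apply: cvgD; first apply: cvgD.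
- by apply: cvgM; exact: cy.
- by apply: cvgM; [apply: cvgM; [exact: cvg_cst|exact: cx]|exact: cy].
- by apply: cvgM; [exact: cvg_cst|apply: cvgM; exact: cx].
Qed.

(** The graph of the hat over its support is a paraboloid over the ellipse of area
2 pi r / sqrt (4 a - b ^ 2); the powers of r in its height and in this area cancel.
The slices at constant x are parabolas, once the square is completed in y. *)
Lemma integral_hat r : 0 < r ->
  (\int[(lebesgue_measure \x lebesgue_measure)%E]_z (hat r (tilde_norm z))%:E =
   (2 * pi / Num.sqrt (4 * a - b ^+ 2))%:E)%E.
Proof.
move=> r0; set D := 4 * a - b ^+ 2.
have sD : 0 < Num.sqrt D by rewrite sqrtr_gt0.
pose m := Num.sqrt D / 2; have m0 : 0 < m by rewrite divr_gt0.
have m2 : m ^+ 2 = D / 4 by rewrite /m expr_div_n sqr_sqrtr ?ltW //; field.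
have cpos (c : R -> R) : continuous c -> continuous (fun s => Num.max 0 (c s)).
  by move=> cc s; apply: (@continuous_max _ _ (cst 0) c); [exact: cvg_cst|exact: cc].
have cH : continuous (hat r \o tilde_norm).
  move=> z; apply: continuous_comp; first exact: continuous_tilde_norm.
  apply: cvgM; first exact: cvg_cst.
  by apply: (cpos (fun s => r - s)) => s; apply: cvgB; [exact: cvg_cst|exact: cvg_id].
have mH : measurable_fun setT (hat r \o tilde_norm).
  by apply: continuous_plane_measurable_fun; [exact: openT|exact: continuous_subspaceT].
rewrite fubini_tonelli1 /fubini_F /=; last first.
- by move=> z; rewrite lee_fin hat_ge0.
- exact/measurable_EFinP.
transitivity (\int[@lebesgue_measure R]_x ((8 / (3 * r ^+ 2))%:E *
   ((r - m ^+ 2 * (x - zeta.1) ^+ 2) * Num.sqrt (r - m ^+ 2 * (x - zeta.1) ^+ 2))%:E))%E.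
  apply: eq_integral => x _.
  (* On this slice the form is (y + k) ^ 2 + m ^ 2 (x - zeta.1) ^ 2. *)
  pose k := b * (x - zeta.1) / 2 - zeta.2.
  rewrite -EFinM (_ : 8 / (3 * r ^+ 2) * _ = 2 / r ^+ 2 * (4 / 3 *
    ((r - m ^+ 2 * (x - zeta.1) ^+ 2) * Num.sqrt (r - m ^+ 2 * (x - zeta.1) ^+ 2)))); last first.
    by field; rewrite gt_eqF.
  rewrite [in RHS]EFinM -(integral_parabola k) -ge0_integralZl //.
  - apply: eq_integral => y _; rewrite -EFinM /hat; congr (_ * Num.max _ _)%:E.
    by rewrite m2 /tilde_norm /k /D /=; field.
  - apply/measurable_EFinP; apply: continuous_measurable_fun; apply: cpos.
    by apply: derivable_continuous => y; apply: ex_derive.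
  - by move=> y _; rewrite lee_fin le_max lexx.
  - by rewrite lee_fin divr_ge0 // sqr_ge0.
have cA : continuous (fun x : R => r - m ^+ 2 * (x - zeta.1) ^+ 2).
  by apply: derivable_continuous => x; apply: ex_derive.
rewrite ge0_integralZl //.
- rewrite integral_ellipse_slices // -EFinM; congr EFin.
  by rewrite /m; field; rewrite !gt_eqF.
- apply/measurable_EFinP; apply: continuous_measurable_fun => x.
  apply: cvgM; first exact: cA.
  by apply: continuous_comp; [exact: cA|exact: sqrt_continuous].
- move=> x _; rewrite lee_fin; have [A0|A0] := lerP 0 (r - m ^+ 2 * (x - zeta.1) ^+ 2).
    by rewrite mulr_ge0 // sqrtr_ge0.
  by rewrite ltr0_sqrtr // mulr0.
- by rewrite lee_fin divr_ge0 // mulr_ge0 // sqr_ge0.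
Qed.

End Form.

(** * Green's formulas for the smoothed quotient *)

(** The Cauchy-Riemann equations of the algebra, in real form. *)
Lemma dbar_eq0 (R : realType) (a b : R) (f : R * R -> gcomplex a b) (z : R * R) : dbar f z = 0 ->
  partial_x (gcRe \o f) z = a * partial_y (gcIm \o f) z /\
  partial_x (gcIm \o f) z =
    b * partial_y (gcIm \o f) z - partial_y (gcRe \o f) z.
Proof.
move=> [e1 e2]; have n2 : 2^-1 != 0 :> R by rewrite invr_eq0.
split; [apply: (mulfI n2); lra|apply: (mulfI n2); lra].
Qed.

Section Smoothing.
Context {R : realType} (a b : R).
Hypothesis hab : 0 < 4 * a - b ^+ 2.
Variables (zeta : R * R) (r : R).
Hypothesis r0 : 0 < r.
Variable Omega : set (R * R).
Hypotheses (oO : open Omega) (bO : bounded_set Omega).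
Hypothesis sub : forall z, tilde_norm a b zeta z < r -> Omega z.
Local Notation Q := (tilde_norm a b zeta).
Local Notation A := (gcomplex a b).
Let K := 2 * pi / Num.sqrt (4 * a - b ^+ 2).

Lemma C1_with_tilde_norm : C1_with Omega Q
  (fun z => 2 * a * (z.1 - zeta.1) + b * (z.2 - zeta.2))
  (fun z => 2 * (z.2 - zeta.2) + b * (z.1 - zeta.1)).
Proof.
have cX := C1_with_fst Omega zeta.1; have cY := C1_with_snd Omega zeta.2.
have cC k := C1_with_cst Omega k.
have := C1_withD (C1_withD (C1_withM cY cY) (C1_withM (C1_withM (cC b) cX) cY))
  (C1_withM (cC a) (C1_withM cX cX)).
by move/C1_with_eq; apply => z; rewrite /tilde_norm; ring.
Qed.

Lemma C1_with_cutoff : C1_with Omega (fun z => cutoff r (Q z))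
  (fun z => dcutoff r (Q z) * (2 * a * (z.1 - zeta.1) + b * (z.2 - zeta.2)))
  (fun z => dcutoff r (Q z) * (2 * (z.2 - zeta.2) + b * (z.1 - zeta.1))).
Proof.
apply: C1_with_comp C1_with_tilde_norm; first by move=> s; exact: is_derive_cutoff.
exact: continuous_dcutoff.
Qed.

Lemma area_hat : area_integral Omega (fun z => hat r (Q z)) = K.
Proof.
rewrite /area_integral /Rintegral integral_mkcond.
rewrite (_ : (_ \_ _)%E = (fun z => (hat r (Q z))%:E)) ?integral_hat //.
apply/funext => z; rewrite patchE; case: ifPn => // zO.
rewrite hat_eq0 // leNgt; apply: contra zO => /sub zO; exact: mem_set.
Qed.

Lemma hat_within : {within closure Omega, continuous (fun z => hat r (Q z))}.
Proof.
have [cc _ _ _] := C1_with_cutoff; have [cQ _ _ _] := C1_with_tilde_norm.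
move=> z; under eq_fun do rewrite hatE //.
apply: cvgD; first exact: cc.
apply: cvgM; first exact: cQ.
apply: continuous_comp; first exact: cQ.
exact: continuous_dcutoff.
Qed.

(** The weight is nonnegative, with total mass K, and lives where g is e-close to k. *)
Lemma area_hat_near (g : R * R -> R) (k e : R) :
  {within closure Omega, continuous g} ->
  (forall z, Q z < r -> `|g z - k| <= e) ->
  `|area_integral Omega (fun z => hat r (Q z) * g z) - K * k| <= K * e.
Proof.
move=> cg ge; have mO := open_plane_measurable oO.
have ih (u : R * R -> R) : {within closure Omega, continuous u} ->
  (lebesgue_measure \x lebesgue_measure)%E.-integrable Omega
    (EFin \o (fun z => hat r (Q z) * u z)).
  move=> cu; apply: continuous_closure_integrable => //.
  by move=> z; apply: cvgM; [exact: hat_within|exact: cu].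
have ik t : (lebesgue_measure \x lebesgue_measure)%E.-integrable Omega
    (EFin \o (fun z => hat r (Q z) * t)).
  by apply: ih => z; exact: cvg_cst.
have i1 : (lebesgue_measure \x lebesgue_measure)%E.-integrable Omega
    (EFin \o (fun z => hat r (Q z))).
  exact: continuous_closure_integrable hat_within.
have EK t : area_integral Omega (fun z => hat r (Q z) * t) = K * t.
  by rewrite /area_integral RintegralZr // -area_hat.
have cd : {within closure Omega, continuous (fun z => hat r (Q z) * g z - hat r (Q z) * k)}.
  move=> z; apply: cvgB; apply: cvgM; [exact: hat_within|exact: cg|exact: hat_within|].
  exact: cvg_cst.
rewrite -EK /area_integral -RintegralB //; last exact: ih.
apply: le_trans (le_normr_Rintegral _ _) _ => //.
  exact: continuous_closure_integrable cd.
rewrite -EK; apply: le_Rintegral => //.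
- by apply: continuous_closure_integrable => // z; apply: cvg_norm; exact: cd.
- move=> z _; rewrite -mulrBr normrM ger0_norm ?hat_ge0 //.
  have [zr|zr] := ltP (Q z) r; last by rewrite hat_eq0 // !mul0r.
  by apply: ler_wpM2l; [exact: hat_ge0|exact: ge].
Qed.

(** The inverse of w is its conjugate over its norm; outside the ellipse, the inverse
of the norm is its cutoff. In contrast to the quotient, the right-hand side
is C1 at zeta when f is. *)
Lemma tilde_div (z : R * R) (f : A) : r <= Q z ->
  f / gc_tilde a b (z - zeta) = GComplex
    ((gcRe f * (z.2 - zeta.2 + b * (z.1 - zeta.1)) - a * gcIm f * (z.1 - zeta.1)) *
       cutoff r (Q z))
    ((gcRe f * (z.1 - zeta.1) + gcIm f * (z.2 - zeta.2)) * cutoff r (Q z)).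
Proof.
move=> rQ; have Q0 : Q z != 0 by rewrite gt_eqF // (lt_le_trans r0).
rewrite cutoff_inv // -[(gc_tilde a b _)^-1]/(gc_inv _) /gc_inv gc_norm_tilde Q0 gc_tildeE.
rewrite (_ : (z - zeta).1 = z.1 - zeta.1) // (_ : (z - zeta).2 = z.2 - zeta.2) //.
set q := Q z in Q0 *.
by congr GComplex; rewrite /=; field.
Qed.

(** Let w be the tilde of z - zeta, w* its conjugate, N = w w* its norm. The function
g = f w* cutoff(N) equals f / w on the boundary, which lies outside the ellipse
N < r. As f and w are holomorphic and (d/dx + i d/dy) w* = b + 2 i,
  (d/dx + i d/dy) g = f (cutoff(N) + w w* cutoff'(N)) (b + 2 i) = f hat(N) (b + 2 i),
so that the formulas of Green and Gauss for g give the result. *)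
Lemma green_smoothed (c : R -> R * R) (f : R * R -> A) :
  smooth_boundary Omega c -> holomorphic_closure Omega f ->
  line_integral_dtilde c (fun z => f z / gc_tilde a b (z - zeta)) =
  (gc_real b + 2 * gc_i) *
    GComplex (area_integral Omega (fun z => hat r (Q z) * gcRe (f z)))
             (area_integral Omega (fun z => hat r (Q z) * gcIm (f z))).
Proof.
move=> [_ _ cO gg] [f1C f2C fh].
have [f1x [f1y c1]] := C1_closure_with f1C.
have [f2x [f2y c2]] := C1_closure_with f2C.
have cX := C1_with_fst Omega zeta.1; have cY := C1_with_snd Omega zeta.2.
have cC k := C1_with_cst Omega k.
pose X (z : R * R) := z.1 - zeta.1; pose Y (z : R * R) := z.2 - zeta.2.
pose u z := cutoff r (Q z); pose u' z := dcutoff r (Q z).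
pose Qx z := 2 * a * X z + b * Y z; pose Qy z := 2 * Y z + b * X z.
pose f1 z := gcRe (f z); pose f2 z := gcIm (f z).
pose p1 z := f1 z * (Y z + b * X z) - a * f2 z * X z.
pose p2 z := f1 z * X z + f2 z * Y z.
pose g1 z := p1 z * u z; pose g2 z := p2 z * u z.
pose g1x z := (f1x z * (Y z + b * X z) + b * f1 z - a * (f2x z * X z + f2 z)) * u z
  + p1 z * (u' z * Qx z).
pose g1y z := (f1y z * (Y z + b * X z) + f1 z - a * f2y z * X z) * u z
  + p1 z * (u' z * Qy z).
pose g2x z := (f1x z * X z + f1 z + f2x z * Y z) * u z + p2 z * (u' z * Qx z).
pose g2y z := (f1y z * X z + f2y z * Y z + f2 z) * u z + p2 z * (u' z * Qy z).
have C1 : C1_with Omega g1 g1x g1y.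
  apply: (C1_with_eq (C1_withM (C1_withD (C1_withM c1 (C1_withD cY (C1_withM (cC b) cX)))
    (C1_withM (C1_withM (cC (- a)) c2) cX)) C1_with_cutoff)) => z;
  by rewrite /g1 /g1x /g1y /p1 /u /u' /Qx /Qy /f1 /f2 /X /Y /=; ring.
have C2 : C1_with Omega g2 g2x g2y.
  apply: (C1_with_eq (C1_withM (C1_withD (C1_withM c1 cX) (C1_withM c2 cY))
    C1_with_cutoff)) => z;
  by rewrite /g2 /g2x /g2y /p2 /u /u' /Qx /Qy /f1 /f2 /X /Y /=; ring.
have [gx1 gy1] := gg _ (C1_with_closure C1).
have [gx2 gy2] := gg _ (C1_with_closure C2).
move: gx1 gy1 gx2 gy2.
rewrite (@eq_area _ _ (partial_x g1) g1x); last by move=> z /(C1_withE C1)[].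
rewrite (@eq_area _ _ (partial_y g1) g1y); last by move=> z /(C1_withE C1)[].
rewrite (@eq_area _ _ (partial_x g2) g2x); last by move=> z /(C1_withE C2)[].
rewrite (@eq_area _ _ (partial_y g2) g2y); last by move=> z /(C1_withE C2)[].
move=> gx1 gy1 gx2 gy2.
have onc t : t \in `[0, 1]%classic -> f (c t) / gc_tilde a b (c t - zeta) =
    GComplex (g1 (c t)) (g2 (c t)).
  move=> t01; rewrite tilde_div //.
  have [_ ct] : (closure Omega `\` Omega) (c t) by rewrite -cO; exists t => //; exact: set_mem.
  by rewrite leNgt; apply/negP => /sub.
rewrite /line_integral_dtilde /gc_line_integral_dy /gc_line_integral_dx.
pose F z := f z / gc_tilde a b (z - zeta).
have E1y : line_integral_dy c (gcRe \o F) = line_integral_dy c g1.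
  by apply: eq_Rintegral => t /onc; rewrite /comp /F => ->.
have E2y : line_integral_dy c (gcIm \o F) = line_integral_dy c g2.
  by apply: eq_Rintegral => t /onc; rewrite /comp /F => ->.
have E1x : line_integral_dx c (gcRe \o F) = line_integral_dx c g1.
  by apply: eq_Rintegral => t /onc; rewrite /comp /F => ->.
have E2x : line_integral_dx c (gcIm \o F) = line_integral_dx c g2.
  by apply: eq_Rintegral => t /onc; rewrite /comp /F => ->.
have {gx1}E1y : line_integral_dy c (gcRe \o F) = area_integral Omega g1x :=
  etrans E1y (esym gx1).
have {gx2}E2y : line_integral_dy c (gcIm \o F) = area_integral Omega g2x :=
  etrans E2y (esym gx2).
have {gy1}E1x : line_integral_dx c (gcRe \o F) = - area_integral Omega g1y.
  by rewrite E1x gy1 opprK.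
have {gy2}E2x : line_integral_dx c (gcIm \o F) = - area_integral Omega g2y.
  by rewrite E2x gy2 opprK.
rewrite -/F E1y E2y E1x E2x.
have [_ k1x k1y _] := C1; have [_ k2x k2y _] := C2.
have [k1 _ _ _] := c1; have [k2 _ _ _] := c2.
have kh (w : R * R -> R) : {within closure Omega, continuous w} ->
    {within closure Omega, continuous (fun z => hat r (Q z) * w z)}.
  by move=> cw z; apply: cvgM; [exact: hat_within|exact: cw].
set I1 := area_integral Omega (fun z => hat r (Q z) * gcRe (f z)).
set I2 := area_integral Omega (fun z => hat r (Q z) * gcIm (f z)).
have kI1 := kh _ k1; have kI2 := kh _ k2.
(* The coefficients are written as for [area_linear]; these two equations are the
   coordinates of (d/dx + i d/dy) g = f hat(N) (b + 2 i) after integration. *)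
have Re : 1 * area_integral Omega g1x + (- a) * area_integral Omega g2y =
    b * I1 + (- (2 * a)) * I2.
  rewrite -!(area_linear _ _ oO bO) //.
  apply: eq_area => z Oz; have [] := dbar_eq0 (fh z Oz).
  have [-> ->] := C1_withE c1 Oz; have [-> ->] := C1_withE c2 Oz => e1 e2.
  rewrite /= hatE // /g1x /g2y /p1 /p2 /= e1 e2;
  by rewrite /u /u' /Qx /Qy /f1 /f2 /X /Y /tilde_norm; ring.
have Im : 1 * (1 * area_integral Omega g2x + 1 * area_integral Omega g1y)
   + (- b) * area_integral Omega g2y = 2 * I1 + (- b) * I2.
  have kxy : {within closure Omega, continuous (fun z => 1 * g2x z + 1 * g1y z)}.
    move=> z; apply: cvgD; apply: cvgM;
      [exact: cvg_cst|exact: k2x|exact: cvg_cst|exact: k1y].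
  rewrite -!(area_linear _ _ oO bO) //.
  apply: eq_area => z Oz; have [] := dbar_eq0 (fh z Oz).
  have [-> ->] := C1_withE c1 Oz; have [-> ->] := C1_withE c2 Oz => e1 e2.
  rewrite /= hatE // /g1y /g2x /g2y /p1 /p2 /= e1 e2;
  by rewrite /u /u' /Qx /Qy /f1 /f2 /X /Y /tilde_norm; ring.
move: Re Im; move: (area_integral Omega g1x) (area_integral Omega g1y)
  (area_integral Omega g2x) (area_integral Omega g2y) I1 I2.
move=> a1x a1y a2x a2y {}I1 {}I2 Re Im.
by congr GComplex; rewrite /=; lra.
Qed.

End Smoothing.

(** * The integral formula *)

Lemma eq_of_norm_le (R : realType) (K x y : R) : 0 < K ->
  (forall e, 0 < e -> `|x - y| <= K * e) -> x = y.
Proof.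
move=> K0 H; apply/eqP; rewrite -subr_eq0 -normr_le0; apply/ler_addgt0Pr => e e0.
by have := H (e / K); rewrite divr_gt0 // mulrC divfK ?gt_eqF // add0r; exact.
Qed.

Lemma small_ellipse_near (R : realType) (a b : R) (hab : 0 < 4 * a - b ^+ 2)
    (Omega : set (R * R)) (zeta : R * R) (g1 g2 : R * R -> R) (e : R) :
  open Omega -> Omega zeta -> 0 < e ->
  {within closure Omega, continuous g1} -> {within closure Omega, continuous g2} ->
  exists2 r, 0 < r & forall z, tilde_norm a b zeta z < r ->
    [/\ Omega z, `|g1 z - g1 zeta| <= e & `|g2 z - g2 zeta| <= e].
Proof.
move=> oO Oz e0 cg1 cg2.
have cont g : {within closure Omega, continuous g} ->
    \forall z \near zeta, `|g z - g zeta| <= e.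
  move=> /(continuous_subspaceW (@subset_closure _ Omega)).
  rewrite continuous_open_subspace // => /(_ zeta (mem_set Oz)).
  by move/cvgrPdist_le => /(_ e e0); apply: filterS => z; rewrite distrC.
have near_zeta : \forall z \near zeta,
    [/\ Omega z, `|g1 z - g1 zeta| <= e & `|g2 z - g2 zeta| <= e].
  near=> z; split; near: z; [exact: open_nbhs_nbhs|exact: cont|exact: cont].
have /nbhs_ballP[d /= d0 dz] := near_zeta.
have [r r0 rd] := tilde_norm_small hab zeta d0.
exists r => // z /rd[z1 z2]; apply: dz.
by split; rewrite /ball /= distrC.
Unshelve. all: by end_near. Qed.

Theorem corollary1 (R : realType) (a b : R) (hab : 0 < 4 * a - b ^+ 2)
    (Omega : set (R * R)) (Omega_open : open Omega)
    (Omega_connected : connected Omega)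
    (Omega_simply_connected : simply_connected Omega)
    (Omega_bounded : bounded_set Omega)
    (c : R -> R * R) (Omega_boundary : smooth_boundary Omega c)
    (zeta : R * R) (zeta_in : Omega zeta)
    (f : R * R -> gcomplex a b) (f_hol : holomorphic_closure Omega f) :
  f zeta =
    1 / (2 * gc_real pi * gc_ihat a b) *
    line_integral_dtilde c (fun z => f z / gc_tilde a b (z - zeta)).
Proof.
pose s := Num.sqrt (4 * a - b ^+ 2); have s0 : 0 < s by rewrite sqrtr_gt0.
pose K := 2 * pi / s; have K0 : 0 < K by rewrite divr_gt0 // mulr_gt0 // pi_gt0.
pose beta : gcomplex a b := gc_real b + 2 * gc_i.
have betaU : beta \is a GRing.unit.
  rewrite gc_elliptic_unit //; apply/eqP => -[_] /eqP.
  by rewrite (_ : _ + _ = 2) ?pnatr_eq0 //=; ring.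
have KU : (gc_real K : gcomplex a b) \is a GRing.unit.
  rewrite gc_elliptic_unit //; apply/eqP => -[] /eqP.
  by rewrite gt_eqF.
have [[cf1 _] [cf2 _] _] := f_hol.
set L := line_integral_dtilde _ _.
(* The line integral does not depend on r, so the averages I1 and I2 do not
   either: they equal their limits as the ellipse shrinks to zeta. *)
have H e : 0 < e -> exists I1 I2 : R, [/\ L = beta * GComplex I1 I2,
    `|I1 - K * gcRe (f zeta)| <= K * e & `|I2 - K * gcIm (f zeta)| <= K * e].
  move=> e0; have [r r0 rz] := small_ellipse_near hab Omega_open zeta_in e0 cf1 cf2.
  have rO z : tilde_norm a b zeta z < r -> Omega z by case/rz.
  exists (area_integral Omega (fun z => hat r (tilde_norm a b zeta z) * gcRe (f z))).
  exists (area_integral Omega (fun z => hat r (tilde_norm a b zeta z) * gcIm (f z))).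
  split; first exact: green_smoothed.
    by apply: (area_hat_near hab r0 Omega_open Omega_bounded rO cf1) => z /rz[].
  by apply: (area_hat_near hab r0 Omega_open Omega_bounded rO cf2) => z /rz[].
have LE : L = beta * (gc_real K * f zeta).
  rewrite -[LHS](mulVKr betaU); congr (_ * _).
  have coord e : 0 < e -> `|gcRe (beta^-1 * L) - K * gcRe (f zeta)| <= K * e /\
      `|gcIm (beta^-1 * L) - K * gcIm (f zeta)| <= K * e.
    by move=> /H[I1 [I2 [-> ? ?]]]; rewrite mulKr.
  case E : (beta^-1 * L) => [x y]; rewrite E /= in coord.
  have -> : x = K * gcRe (f zeta) by apply: (eq_of_norm_le K0) => e /coord[].
  have -> : y = K * gcIm (f zeta) by apply: (eq_of_norm_le K0) => e /coord[].
  by congr GComplex; rewrite /=; ring.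
have -> : 2 * gc_real pi * gc_ihat a b = beta * gc_real K.
  have sK : gc_real s * gc_real K = 2 * gc_real pi :> gcomplex a b.
    by congr GComplex; rewrite /= /K; field; rewrite gt_eqF.
  have sU : (gc_real s : gcomplex a b) \is a GRing.unit.
    by rewrite gc_elliptic_unit //; apply/eqP => -[] /eqP; rewrite gt_eqF.
  by rewrite /gc_ihat -/beta -/s -sK mulrCA mulrA mulrAC -mulrA mulKr // mulrC.
by rewrite LE div1r mulrA mulKr ?unitrM ?betaU.
Qed.
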